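(* Let $H$ be a real Hilbert space and let $K\subseteq H$ be a pointed closed convex cone. Then $K$ is subdual (i.e. $K\subseteq K^*$) if and only if the function $H\to\mathbb{R}$, $x\mapsto\lVert P_Kx\rVert$, is $K$-isotone, i.e. for all $x,y\in H$, $x\le_K y$ implies $\lVert P_Kx\rVert\le\lVert P_Ky\rVert$.
   Context: $H$ is a real Hilbert space with inner product $\langle\cdot,\cdot\rangle$ and norm $\lVert x\rVert=\sqrt{\langle x,x\rangle}$. A closed convex cone is a nonempty closed set $K\subseteq H$ such that $\lambda x+\mu y\in K$ for all $x,y\in K$ and all real $\lambda,\mu\ge 0$. It is pointed if $K\cap(-K)=\{0\}$. The relation $\le_K$ is defined by $x\le_K y\iff y-x\in K$. The dual cone is $K^*=\{x\in H:\langle x,y\rangle\ge 0\text{ for every }y\in K\}$. $K$ is subdual if $K\subseteq K^*$. $P_Kx$ denotes the metric projection of $x$ onto $K$, i.e. the unique point of $K$ with $\lVert x-P_Kx\rVert=\min_{y\in K}\lVert x-y\rVert$. *)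

(* Defs.v *)
From HB Require Import structures.
From mathcomp Require Import all_boot all_order all_algebra.
From mathcomp Require Import all_classical all_reals all_analysis.

Set Implicit Arguments.
Unset Strict Implicit.
Unset Printing Implicit Defensive.

Import Order.TTheory GRing.Theory Num.Theory.
Import numFieldNormedType.Exports.

Local Open Scope classical_set_scope.
Local Open Scope ring_scope.

(* A positive definite symmetric bilinear form inducing the existing norm, and
   hence the existing topology and uniform structure. *)
HB.mixin Record NormedModule_hasInner (R : realType) (H : Type)
    of NormedModule R H := {
  inner : {dot H for @idfun R} ;
  normr_inner : forall x : H, `|x| = Num.sqrt (inner x x)
}.

#[short(type="hilbertType")]
HB.structure Definition Hilbert (R : realType) :=
  {H of CompleteNormedModule R H & NormedModule_hasInner R H}.

Section Cones.
Context {R : realType} {H : hilbertType R}.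
Implicit Types (K : set H) (x y : H).

Definition closed_convex_cone K : Prop :=
  [/\ K !=set0, closed K &
      forall x y (a b : R), K x -> K y -> 0 <= a -> 0 <= b ->
        K (a *: x + b *: y)].

Definition pointed_cone K : Prop := K `&` (-%R @` K) = [set 0].

Definition cone_le K x y : Prop := K (y - x).

Definition dual_cone K : set H :=
  [set x | forall y, K y -> 0 <= inner x y].

Definition subdual K : Prop := K `<=` dual_cone K.

(* Equal to the default value of [get] when no minimizer exists; on a nonempty
   closed convex K the minimizer exists and is unique. *)
Definition metric_proj K x : H :=
  get [set p | K p /\ forall y, K y -> `|x - p| <= `|x - y|].

Definition isotone K (f : H -> R) : Prop :=
  forall x y, cone_le K x y -> f x <= f y.

End Cones.

(* Main.v *)
Require Import Defs.
From mathcomp Require Import all_boot all_order all_algebra.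
From mathcomp Require Import all_classical all_reals all_analysis.
From mathcomp Require Import ring lra.

Import Order.TTheory GRing.Theory Num.Theory.
Import numFieldNormedType.Exports.

Local Open Scope classical_set_scope.
Local Open Scope ring_scope.

(** The whole argument rests on two properties of the projection [p] of [x]
    onto a closed convex cone [K]: [x - p] is orthogonal to [p], and it makes
    a nonpositive inner product with every element of [K].

    If [K] is subdual and [y - x] lies in [K], then [inner (y - x) p] is
    nonnegative because [p] also lies in [K].  With [q] the projection of [y],
    this gives
      [`|p|^2 = inner x p <= inner y p <= inner q p <= `|q| * `|p|],
    hence [`|p| <= `|q|].

    Conversely, elements of [K] are their own projections.  For [x], [y] in
    [K] and [t >= 0] the points [x] and [x + t *: y] both lie in [K] and are
    ordered, so isotonicity says that [`|x| <= `|x + t *: y|]; letting [t] tend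
    to [0] makes the first order term [inner x y] nonnegative.

    This first order argument ([inner_ge0_of_normD_ge]) also yields the two
    properties of the projection, by moving [p] inside [K] along a direction
    of the cone and towards the origin.  The projection exists
    ([exists_nearest_point]) because, by the parallelogram law, the
    almost-nearest points of [K] form a Cauchy filter. *)

(** * Inner product and norm *)

Lemma inner_sym {R : realType} {H : hilbertType R} (x y : H) :
  inner x y = inner y x.
Proof. by rewrite hermC expr0 mul1r. Qed.

Lemma inner_ge0 {R : realType} {H : hilbertType R} (x : H) : 0 <= inner x x.
Proof.
have [->|x0] := eqVneq x 0; first by rewrite linear0l.
exact/ltW/neq0_dnorm_gt0.
Qed.

Lemma sqr_normE {R : realType} {H : hilbertType R} (x : H) :
  `|x| ^+ 2 = inner x x.
Proof. by rewrite normr_inner sqr_sqrtr ?inner_ge0. Qed.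

Lemma sqr_normD {R : realType} {H : hilbertType R} (u v : H) :
  `|u + v| ^+ 2 = `|u| ^+ 2 + 2 * inner u v + `|v| ^+ 2.
Proof.
by rewrite !sqr_normE linearDl !linearDr /= (inner_sym v u); ring.
Qed.

Lemma sqr_normZ {R : realType} {H : hilbertType R} (a : R) (u : H) :
  `|a *: u| ^+ 2 = a ^+ 2 * `|u| ^+ 2.
Proof. by rewrite normrZ exprMn real_normK ?num_real. Qed.

Lemma inner_le_norm {R : realType} {H : hilbertType R} (u v : H) :
  inner u v <= `|u| * `|v|.
Proof.
(* Expanding the triangle inequality, squared. *)
have : `|u + v| ^+ 2 <= (`|u| + `|v|) ^+ 2.
  by rewrite ler_sqr ?nnegrE ?addr_ge0 // ler_normD.
by rewrite sqr_normD sqrrD; lra.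
Qed.

Lemma parallelogram_midpoint {R : realType} {H : hilbertType R} (x p q : H) :
  `|p - q| ^+ 2 + 4 * `|x - (2^-1 *: p + 2^-1 *: q)| ^+ 2
  = 2 * `|x - p| ^+ 2 + 2 * `|x - q| ^+ 2.
Proof.
have -> : p - q = (x - q) + -1 *: (x - p).
  by rewrite scaleN1r opprB [RHS]addrC addrA subrK.
have -> : x - (2^-1 *: p + 2^-1 *: q) = 2^-1 *: ((x - q) + (x - p)).
  rewrite [X in _ = _ *: X]addrACA -opprD scalerBr -mulr2n -(scaler_nat _ x) scalerA.
  by rewrite mulVf ?pnatr_eq0 // scale1r scalerDr [_ *: q + _]addrC.
move: (x - q) (x - p) => u v.
rewrite sqr_normZ !sqr_normD sqr_normZ linearZr_LR /=.
by field.
Qed.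

(** If [inner u v] were negative, the linear term would win over [t ^+ 2] and
    small steps from [u] along [v] would shorten [u]. *)
Lemma inner_ge0_of_normD_ge {R : realType} {H : hilbertType R} (u v : H) :
  (forall t : R, 0 < t <= 1 -> `|u| <= `|u + t *: v|) -> 0 <= inner u v.
Proof.
move=> hmin; rewrite leNgt; apply/negP => c0.
set c := inner u v in c0; set b := `|v| ^+ 2.
have b0 : 0 <= b by exact: sqr_ge0.
have bc0 : 0 < b - c by lra.
(* Any step shorter than [- 2 * c / b] shortens [u]; this one is also at most
   [1], and it makes sense when [b = 0]. *)
pose t := - c / (b - c).
have t0 : 0 < t by rewrite divr_gt0 // oppr_gt0.
have t1 : t <= 1 by rewrite ler_pdivrMr // mul1r; lra.
have tE : t * (b - c) = - c by rewrite divfK // gt_eqF.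
have : `|u| ^+ 2 <= `|u + t *: v| ^+ 2.
  by rewrite ler_sqr ?nnegrE // hmin // t0 t1.
rewrite sqr_normD sqr_normZ linearZr_LR /= -/c -/b => hle.
have : 0 <= t * (2 * c + t * b) by lra.
by rewrite pmulr_rge0 // => ?; have : t * c < 0 by [rewrite pmulr_rlt0]; lra.
Qed.

(** * Existence of nearest points *)

(** The points of [C] whose squared distance to [x] exceeds the infimum by less
    than [e] have diameter at most [2 * sqrt e], by the parallelogram law and
    because their midpoints stay in [C].  They generate a Cauchy filter, whose
    limit is the nearest point. *)
Lemma exists_nearest_point {R : realType} {H : hilbertType R} (C : set H)
    (x : H) :
  C !=set0 -> closed C ->
  (forall p q, C p -> C q -> C (2^-1 *: p + 2^-1 *: q)) ->
  exists p, C p /\ forall y, C y -> `|x - p| <= `|x - y|.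
Proof.
move=> [c0 Cc0] clC midC.
pose E := [set `|x - y| ^+ 2 | y in C].
pose D := inf E.
have lbE : lbound E 0 by move=> _ [y _ <-]; exact: sqr_ge0.
have infE : has_inf E by split; [exists (`|x - c0| ^+ 2), c0 | exists 0].
have D_le y : C y -> D <= `|x - y| ^+ 2.
  by move=> Cy; apply: ge_inf; [exists 0 | exists y].
pose A (e : R) := [set y | C y /\ `|x - y| ^+ 2 < D + e].
pose F := filter_from [set e : R | 0 < e] A.
have FF : ProperFilter F.
  apply: filter_from_proper.
    apply: filter_from_filter; first by exists 1 => /=.
    move=> e f /= e0 f0; exists (Order.min e f); first by rewrite /= lt_min e0 f0.
    move=> y [Cy]; rewrite -ltrBlDl lt_min => /andP[ye yf].
    by split; split => //; lra.
  by move=> e /= e0; have [_ [y Cy <-] yD] := inf_adherent e0 infE; exists y.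
have cauchyF : cauchy F.
  apply: cauchy_exP => e e0.
  have e40 : 0 < e ^+ 2 / 4 by rewrite divr_gt0 // exprn_gt0.
  have [_ [p Cp <-] pD] := inf_adherent e40 infE.
  exists p; exists (e ^+ 2 / 4) => //= q [Cq qD].
  rewrite -ball_normE /= -ltr_sqr ?nnegrE ?(ltW e0) //.
  have := parallelogram_midpoint x p q.
  have := D_le _ (midC _ _ Cp Cq).
  rewrite -/D in pD; lra.
have cvgF : cvg F by exact/cauchy_cvgP.
exists (lim F); split.
  apply: (@closed_cvg _ _ F FF id C clC _ _ cvgF).
  by exists 1 => //= y [].
move=> y Cy; rewrite -ler_sqr ?nnegrE //.
apply: le_trans (D_le _ Cy); apply/ler_addgt0Pr => e e0.
have hlim : `|x - z| ^+ 2 @[z --> F] --> `|x - lim F| ^+ 2.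
  have h : `|x - z| @[z --> F] --> `|x - lim F|.
    by apply: cvg_norm; apply: cvgB; [exact: cvg_cst | exact: cvgF].
  by rewrite expr2; under eq_fun do rewrite expr2; exact: cvgM.
apply: (cvgr_to_le hlim).
by exists e => //= z [_ /ltW].
Qed.

(** * Projection onto a closed convex cone *)

Section ConeProjection.
Context {R : realType} {H : hilbertType R} (K : set H).
Hypothesis hK : closed_convex_cone K.

Lemma cone_add x y : K x -> K y -> K (x + y).
Proof.
by case: hK => _ _ h Kx Ky; have := h x y 1 1 Kx Ky ler01 ler01; rewrite !scale1r.
Qed.

Lemma cone_scale (a : R) x : 0 <= a -> K x -> K (a *: x).
Proof.
by case: hK => _ _ h a0 Kx; have := h x x a 0 Kx Kx a0 (lexx 0);
   rewrite scale0r addr0.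
Qed.

Lemma metric_projP x :
  K (metric_proj K x) /\
  forall y, K y -> `|x - metric_proj K x| <= `|x - y|.
Proof.
case: hK => K0 clK convK.
apply: (@getPex _ [set p | K p /\ forall y, K y -> `|x - p| <= `|x - y|]).
apply: exists_nearest_point => // p q Kp Kq.
by apply: convK => //; rewrite invr_ge0 ler0n.
Qed.

Lemma metric_proj_id x : K x -> metric_proj K x = x.
Proof.
move=> Kx; have [_ /(_ x Kx)] := metric_projP x.
by rewrite subrr normr0 normr_le0 subr_eq0 => /eqP.
Qed.

(** The competitors [p + t *: k] of the projection [p] lie in [K]. *)
Lemma inner_residual_le0 x k : K k -> inner (x - metric_proj K x) k <= 0.
Proof.
move=> Kk; have [Kp hp] := metric_projP x.
rewrite -oppr_ge0 -linearNr; apply: inner_ge0_of_normD_ge => t /andP[t0 _].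
by rewrite scalerN -addrA -opprD; apply/hp/cone_add/cone_scale => //; exact: ltW.
Qed.

(** The competitors [(1 - t) *: p] of the projection [p] lie in [K] too, which
    reverses the previous inequality in the direction of [p]. *)
Lemma inner_residual_proj x :
  inner (x - metric_proj K x) (metric_proj K x) = 0.
Proof.
have [Kp hp] := metric_projP x.
apply/eqP; rewrite eq_le inner_residual_le0 //=.
apply: inner_ge0_of_normD_ge => t /andP[_ t1].
have -> : x - metric_proj K x + t *: metric_proj K x
          = x - (1 - t) *: metric_proj K x.
  by rewrite scalerBl scale1r opprB addrA addrAC.
by apply/hp/cone_scale; rewrite ?subr_ge0.
Qed.

Lemma isotone_norm_proj_of_subdual :
  subdual K -> isotone K (fun x : H => `|metric_proj K x|).
Proof.
move=> sd x y Kyx /=.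
have [Kp _] := metric_projP x.
set p := metric_proj K x in Kp *; set q := metric_proj K y.
have [->|p0] := eqVneq p 0; first by rewrite normr0.
rewrite -(@ler_pM2r _ `|p|) ?normr_gt0 // -expr2 sqr_normE.
apply: le_trans (inner_le_norm q p).
have := sd _ Kyx p Kp.
have := inner_residual_le0 y p Kp.
have := inner_residual_proj x.
by rewrite -/p -/q !linearBl /=; lra.
Qed.

Lemma subdual_of_isotone_norm_proj :
  isotone K (fun x : H => `|metric_proj K x|) -> subdual K.
Proof.
move=> iso x Kx y Ky; apply: inner_ge0_of_normD_ge => t /andP[/ltW t0 _].
have Kty := cone_scale t y t0 Ky.
have := iso x (x + t *: y).
rewrite /= !metric_proj_id //; last exact: cone_add.
by apply; rewrite /cone_le addrC addKr.
Qed.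

End ConeProjection.

Theorem theorem3p2 (R : realType) (H : hilbertType R) (K : set H)
    (hK : closed_convex_cone K) (hpt : pointed_cone K) :
  subdual K <-> isotone K (fun x : H => `|metric_proj K x|).
Proof.
split; first exact: isotone_norm_proj_of_subdual.
exact: subdual_of_isotone_norm_proj.
Qed.
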